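(* Let $\Omega$ be an unbounded domain in $\mathbb C^n$. If there is a bounded holomorphic function $f$ on $\Omega$ that never takes the value zero and satisfies $f(z)\to 0$ as $\|z\|\to\infty$ ($z\in\Omega$), then $\Omega$ is Kobayashi hyperbolic.
   Context: Kobayashi pseudometric and hyperbolicity: for $r>0$ let $\Delta_r(0)=\{\lambda\in\mathbb C:|\lambda|<r\}$. For a complex manifold $M$, $z\in M$ and $v\in T_zM$, let $k_M(z;v)=\inf\{1/r>0:\ \exists f:\Delta_r(0)\to M \text{ holomorphic},\ f(0)=z,\ f'(0)=v\}$. $M$ is Kobayashi hyperbolic if every $p\in M$ has a neighbourhood $U$ and a constant $c>0$ with $k_M(z;v)\ge c\|v\|_g$ for all $z\in U$, $v\in T_zM$, where $\|\cdot\|_g$ is any Hermitian norm on $U$ induced from $\mathbb C^n$. For a domain $\Omega\subset\mathbb C^n$ one uses the Euclidean norm $\|\cdot\|$. *)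

(* Defs.v *)
From HB Require Import structures.
From mathcomp Require Import all_boot all_order all_algebra.
From mathcomp Require Import all_classical all_reals all_analysis.
From mathcomp Require Import complex.

Set Implicit Arguments.
Unset Strict Implicit.
Unset Printing Implicit Defensive.

Import Order.TTheory GRing.Theory Num.Theory.
Import numFieldNormedType.Exports.

Local Open Scope classical_set_scope.
Local Open Scope ring_scope.

(* MathComp-Analysis puts a topology on an abstract numFieldType and on K^o;
   these instances transport it to the concrete field R[i].                  *)
HB.instance Definition _ (R : rcfType) := PseudoPointedMetric.copy R[i] R[i]^o.
HB.instance Definition _ (R : rcfType) := NormedModule.copy R[i] R[i]^o.

(* The Hermitian norm; the norm `|z| of the normedModType 'rV[R[i]]_n is the
   sup norm, which yields the same topology and the same bounded sets.       *)
Definition enorm (R : realType) (n : nat) (z : 'rV[R[i]]_n) : R :=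
  Num.sqrt (\sum_i Normc.normc (z 0 i) ^+ 2).

(* Functions are total; on an open set U, differentiability at the points of U
   only depends on the restriction to U.  Differentiability is over R[i].    *)
Definition holomorphic_on (R : realType) (V W : normedModType R[i])
    (U : set V) (f : V -> W) : Prop :=
  forall z, U z -> differentiable f z.

Definition domain (R : realType) (n : nat) (Omega : set 'rV[R[i]]_n) : Prop :=
  [/\ open Omega, connected Omega & Omega !=set0].

(* The filter "||z|| tends to infinity" on C^n. *)
Definition at_infinity (R : realType) (n : nat) : set_system 'rV[R[i]]_n :=
  filter_from [set: R] (fun r => [set z | r < enorm z]).

Definition disc (R : realType) (r : R) : set R[i] :=
  [set l | Normc.normc l < r].

Definition kobayashi (R : realType) (n : nat) (Omega : set 'rV[R[i]]_n)
    (z v : 'rV[R[i]]_n) : \bar R :=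
  ereal_inf [set (r^-1)%:E | r in [set r : R | 0 < r /\
    exists phi : R[i] -> 'rV[R[i]]_n,
      [/\ holomorphic_on (disc r) phi, phi @` disc r `<=` Omega,
          phi 0 = z & derive1 phi 0 = v]]].

(* Tangent vectors at points of the open set Omega are vectors of C^n. *)
Definition kobayashi_hyperbolic (R : realType) (n : nat)
    (Omega : set 'rV[R[i]]_n) : Prop :=
  forall p, Omega p -> exists U : set 'rV[R[i]]_n, exists c : R,
    [/\ nbhs p U, U `<=` Omega, 0 < c &
        forall z v, U z -> ((c * enorm v)%:E <= kobayashi Omega z v)%E].

(* Main.v *)
Require Import Defs.
From mathcomp Require Import all_boot all_order all_algebra.
From mathcomp Require Import all_classical all_reals all_analysis.
From mathcomp Require Import complex.
From mathcomp Require Import zify ring lra.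
Import Order.TTheory GRing.Theory Num.Theory.
Import numFieldNormedType.Exports.
Local Open Scope classical_set_scope.
Local Open Scope ring_scope.
Set Implicit Arguments.
Unset Strict Implicit.
Unset Printing Implicit Defensive.

(** Let p be a point of Omega and divide f by a bound, so that |f| <= 1 on
    Omega.  Near p one has |f z| >= delta > 0.  Let phi be a holomorphic map of
    the disc of radius r into Omega with phi(0) = z near p, and g = f o phi.
    Since g has no zero on a disc, it has holomorphic roots.  If N = 2^k is so
    large that (3/4)^N <= delta, an N-th root G of g satisfies |G| <= 1 and
    |G(0)| >= 3/4.  A bounded holomorphic function oscillates slowly near the
    centre of its disc, so |G| >= 1/2, hence |f o phi| >= 2^-N, on a disc of
    radius c r, where c depends on k only ([nonvanishing_lower_bound]).  As f
    tends to 0 at infinity, phi maps that disc into a bounded set which depends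
    on p only, and the Cauchy estimate bounds phi'(0) by a constant times 1/r.
    That is the lower bound on the Kobayashi metric.

    The one-variable theory needed is the Cauchy estimate |h'(z)| <= 4 K / r
    for a function that is only assumed complex differentiable
    ([cauchy_estimate]), and the existence of square roots
    ([holomorphic_sqrt]).

    The estimate is obtained without integrals.  Contour integrals along squares
    are replaced by trapezoid sums, each edge being cut into 2^m parts.  These
    are exactly additive when a square is cut into four, and exactly zero on affine
    functions, so that Goursat's bisection argument shows that they tend to 0 as
    m grows ([goursat]).  This is applied to
    (h w - h 0 - h'(0) w) / w^2, which is o(1/w) at 0; the contribution of
    h(0) / w^2 vanishes by parity, and the sums of 1/w have imaginary part at
    least 4 (their limit is 2 pi i), which isolates h'(0).

    The square root of g is the product of a square root of g 0 and of the
    principal square roots of the ratios g((j+1) w / N) / g(j w / N), j < N,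
    which all lie in the right half plane when N is large.

    All compactness arguments go through one bisection principle for
    properties of squares, [square_bisection]. *)

(** * The modulus of a complex number, and bisection of squares *)

(** The real-valued modulus, in contrast with the norm [`|z|], which takes
    its values in [R[i]]. *)
Local Notation nrm := (@Normc.normc _).

Section Modulus.
Variable R : realType.
Implicit Types (z w : R[i]) (x u v : R).

Lemma normC_nrm z : `|z| = (nrm z)%:C%C.
Proof. by []. Qed.

Lemma nrm_ge0 z : 0 <= nrm z.
Proof. by case: z => a b; exact: sqrtr_ge0. Qed.

Lemma nrm_eq0 z : (nrm z == 0) = (z == 0).
Proof.
by apply/eqP/eqP => [/Normc.eq0_normc//|->]; exact: Normc.normc0.
Qed.

Lemma nrm_gt0 z : (0 < nrm z) = (z != 0).
Proof. by rewrite lt_def nrm_ge0 andbT nrm_eq0. Qed.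

Lemma nrmD z w : nrm (z + w) <= nrm z + nrm w.
Proof. exact: le_normcD. Qed.

Lemma nrmN z : nrm (- z) = nrm z.
Proof. exact: normcN. Qed.

Lemma nrmB z w : nrm (z - w) <= nrm z + nrm w.
Proof. by rewrite (le_trans (nrmD _ _))// nrmN. Qed.

Lemma nrmBC z w : nrm (z - w) = nrm (w - z).
Proof. by rewrite -nrmN opprB. Qed.

Lemma nrmM z w : nrm (z * w) = nrm z * nrm w.
Proof. exact: Normc.normcM. Qed.

Lemma nrmX z n : nrm (z ^+ n) = nrm z ^+ n.
Proof.
by elim: n => [|n IH]; rewrite ?expr0 ?exprS ?Normc.normc1 ?nrmM ?IH.
Qed.

Lemma nrmV z : nrm z^-1 = (nrm z)^-1.
Proof. exact: Normc.normcV. Qed.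

Lemma nrm_real x : nrm (x%:C)%C = `|x|.
Proof. by rewrite /= expr0n addr0 sqrtr_sqr. Qed.

Lemma nrm_i : nrm ('i%C : R[i]) = 1.
Proof. by rewrite /= expr0n expr1n add0r sqrtr1. Qed.

Lemma ReD z w : complex.Re (z + w) = complex.Re z + complex.Re w.
Proof. by case: z w => [a b] [c d]. Qed.

Lemma ImD z w : complex.Im (z + w) = complex.Im z + complex.Im w.
Proof. by case: z w => [a b] [c d]. Qed.

Lemma Re_le_nrm z : `|complex.Re z| <= nrm z.
Proof. by have := normc_ge_Re z; rewrite normC_nrm lecR. Qed.

Lemma Im_le_nrm z : `|complex.Im z| <= nrm z.
Proof.
case: z => a b /=; rewrite -sqrtr_sqr ler_wsqrtr// lerDr sqr_ge0//.
Qed.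

Lemma nrm_le_ReIm z : nrm z <= `|complex.Re z| + `|complex.Im z|.
Proof.
case: z => a b /=; rewrite -(@ler_pXn2r _ 2)// ?nnegrE ?sqrtr_ge0 ?addr_ge0//.
rewrite sqr_sqrtr ?addr_ge0 ?sqr_ge0// sqrrD !real_normK ?num_real//.
by rewrite addrAC lerDl mulrn_wge0// mulr_ge0.
Qed.

Lemma nrm_lt_square x u v : 0 < x -> `|u| <= x / 2 -> `|v| <= x / 2 ->
  nrm (u +i* v)%C < x.
Proof.
move=> x0 up vp; rewrite -(@ltr_pXn2r _ 2)// ?nnegrE ?nrm_ge0 ?ltW//.
rewrite /= sqr_sqrtr ?addr_ge0 ?sqr_ge0//.
have p0 : 0 < x / 2 by rewrite divr_gt0.
have -> : x ^+ 2 = 4 * (x / 2) ^+ 2 by field.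
have : u ^+ 2 <= (x / 2) ^+ 2.
  by rewrite -real_normK ?num_real// ler_pXn2r ?nnegrE ?(ltW p0).
have : v ^+ 2 <= (x / 2) ^+ 2.
  by rewrite -real_normK ?num_real// ler_pXn2r ?nnegrE ?(ltW p0).
have : 0 < (x / 2) ^+ 2 by rewrite exprn_gt0.
lra.
Qed.

End Modulus.

Section Bisection.
Variable R : realType.

Lemma nested_intervals (x s : nat -> R) :
  (forall k, 0 <= s k) -> (forall k, x k <= x k.+1) ->
  (forall k, x k.+1 + s k.+1 <= x k + s k) ->
  exists a, forall k, x k <= a <= x k + s k.
Proof.
move=> s0 xle xsle.
have xmono : {homo x : m n / (m <= n)%N >-> m <= n} by apply: homo_leq le_trans _.
have xsmono : forall m n, (m <= n)%N -> x n + s n <= x m + s m.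
  move=> m n; elim: n => [|n IH]; first by rewrite leqn0 => /eqP ->.
  by rewrite leq_eqVlt => /orP[/eqP ->//|]; rewrite ltnS => /IH; exact: le_trans.
have ub k : ubound (range x) (x k + s k).
  move=> _ [j _ <-]; have [jk|/ltnW kj] := leqP j k.
    by rewrite (le_trans (xmono _ _ jk))// lerDl.
  by rewrite (le_trans _ (xsmono _ _ kj))// lerDl.
exists (sup (range x)) => k; apply/andP; split.
  by apply: ub_le_sup; [exists (x 0%N + s 0%N); exact: ub | exists k].
by apply: ge_sup; [exists (x 0%N), 0%N | exact: ub].
Qed.

(** Squares are given by the real coordinates [x], [y] of the lower left corner
    and the side [s].  A property that passes from the four quarters of a
    square to the square, and that holds for all small squares around each
    point, holds for every square. *)
Lemma square_bisection (P : R -> R -> R -> Prop) (x0 y0 s0 : R) :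
  (forall x y s, 0 < s -> P x y (s / 2) -> P (x + s / 2) y (s / 2) ->
     P x (y + s / 2) (s / 2) -> P (x + s / 2) (y + s / 2) (s / 2) -> P x y s) ->
  (forall a b, x0 <= a <= x0 + s0 -> y0 <= b <= y0 + s0 ->
     exists2 d, 0 < d & forall x y s, 0 < s -> s < d ->
       x <= a <= x + s -> y <= b <= y + s -> P x y s) ->
  0 < s0 -> P x0 y0 s0.
Proof.
move=> Psub Ploc s0_gt0; apply: contrapT => nP.
pose Q (t : R * R * R) := 0 < t.2 /\ ~ P t.1.1 t.1.2 t.2.
pose child (t u : R * R * R) := [/\ u.2 = t.2 / 2,
  t.1.1 <= u.1.1, u.1.1 + u.2 <= t.1.1 + t.2,
  t.1.2 <= u.1.2 & u.1.2 + u.2 <= t.1.2 + t.2].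
(* If the property fails on a square, it fails on one of its quarters. *)
have step t : exists u, Q t -> child t u /\ Q u.
  have [[t0 nt]|nQ] := pselect (Q t); last by exists t.
  case: t t0 nt => -[x y] s /= s_gt0 nPt.
  have h0 : 0 < s / 2 by rewrite divr_gt0.
  apply: contrapT => nex; apply: nPt.
  apply: Psub => //; apply: contrapT => nPu; apply: nex;
    [ exists (x, y, s / 2) | exists (x + s / 2, y, s / 2)
    | exists (x, y + s / 2, s / 2) | exists (x + s / 2, y + s / 2, s / 2)];
    move=> _; (split; last by split); split => //=; lra.
have [nxt nxtP] := choice step.
pose u k := iter k nxt (x0, y0, s0).
have Qu k : Q (u k) by elim: k => [|k /nxtP[]].
have cu k : child (u k) (u k.+1) by have [] := nxtP _ (Qu k).
have s_ge0 k : 0 <= (u k).2 by have [/ltW] := Qu k.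
have [a aP] : exists a, forall k, (u k).1.1 <= a <= (u k).1.1 + (u k).2.
  by apply: nested_intervals => // k; have [] := cu k.
have [b bP] : exists b, forall k, (u k).1.2 <= b <= (u k).1.2 + (u k).2.
  by apply: nested_intervals => // k; have [] := cu k.
have [d d0 dP] := Ploc a b (aP 0%N) (bP 0%N).
have sE k : (u k).2 = s0 / 2 ^+ k.
  elim: k => [|k IH]; first by rewrite expr0 divr1.
  by have [-> _ _ _ _] := cu k; rewrite IH exprSr invfM mulrA.
have [k kP] : exists k, (u k).2 < d.
  have [k kP] : exists k : nat, s0 / d < k%:R.
    by exists (Num.truncn (s0 / d)).+1; exact: truncnS_gt.
  exists k; rewrite sE ltr_pdivrMr ?exprn_gt0//.
  rewrite ltr_pdivrMr// in kP; rewrite (lt_trans kP)// mulrC ltr_pM2l//.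
  by rewrite -natrX ltr_nat ltn_expl.
have [sk_gt0] := Qu k; apply; exact: dP.
Qed.

End Bisection.

(** * Complex differentiability in epsilon-delta form *)

Section ComplexDerivative.
Variable R : realType.
Implicit Types (h : R[i] -> R[i]) (z d w : R[i]).

(** The function [h] has complex derivative [d] at [z]. *)
Definition cderiv h z d := forall eps : R, 0 < eps ->
  exists2 delta : R, 0 < delta & forall w, nrm (w - z) < delta ->
    nrm (h w - h z - d * (w - z)) <= eps * nrm (w - z).

Lemma quotient_remainder (q d u : R[i]) : u != 0 ->
  q - d * u = - (d - u^-1 * q) * u.
Proof. by move=> u0; rewrite opprB mulrBl mulrAC mulVf// mul1r. Qed.

Lemma nbhs_nrm (z : R[i]) (A : set R[i]) :
  nbhs z A <-> exists2 e : R, 0 < e & forall w, nrm (w - z) < e -> A w.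
Proof.
rewrite -nbhs_nbhs_norm; split=> [[e /= e0 eA]|[e e0 eA]].
  have eE : e = (complex.Re e)%:C%C by rewrite RRe_real// gtr0_real.
  exists (complex.Re e); first by rewrite -ltcR -eE.
  by move=> w wz; apply: eA; rewrite /ball_/= distrC eE normC_nrm ltcR.
exists e%:C%C; first by rewrite /= ltcR.
by move=> w /=; rewrite distrC normC_nrm ltcR => /eA.
Qed.

Lemma differentiable_cderiv h z :
  differentiable h z -> cderiv h z (derive1 h z).
Proof.
move=> /derivable1_diffP dh e e0.
have : (fun u => u^-1 *: (h (u + z) - h z)) @ 0^' --> derive1 h z.
  rewrite derive1E; move: dh; rewrite /derivable /derive.
  suff -> : (fun u : R[i] => u^-1 *: ((h \o shift z) u%:A - h z)) =
    (fun u => u^-1 *: (h (u + z) - h z)) by [].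
  by apply/funext => u /=; rewrite [u%:A]mulr1.
move=> /cvgrPdist_lt /(_ e%:C%C); rewrite ltcR => /(_ e0) /nbhs_nrm[d d0 dP].
exists d => // w wz; have [->|wz0] := eqVneq w z.
  by rewrite !subrr mulr0 subrr Normc.normc0 mulr0.
have {dP} := dP (w - z); rewrite subr0 => /(_ wz); rewrite subr_eq0 => /(_ wz0).
rewrite subrK normC_nrm ltcR => lt.
have -> : h w - h z - derive1 h z * (w - z) =
    - (derive1 h z - (w - z)^-1 *: (h w - h z)) * (w - z).
  by apply: quotient_remainder; rewrite subr_eq0.
by rewrite nrmM nrmN ler_wpM2r ?nrm_ge0 ?(ltW lt).
Qed.

Lemma cderiv_differentiable h z d : cderiv h z d -> differentiable h z.
Proof.
move=> dh; apply/derivable1_diffP.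
have cv : (fun u => u^-1 *: (h (u + z) - h z)) @ 0^' --> d.
  apply/cvgrPdist_le => e e0.
  have eE : e = (complex.Re e)%:C%C by rewrite RRe_real// gtr0_real.
  have e0' : 0 < complex.Re e by rewrite -ltcR -eE.
  apply/nbhs_nrm; have [del del0 delP] := dh _ e0'.
  exists del => // u; rewrite subr0 => u_lt u_neq0; have := delP (u + z).
  rewrite addrK => /(_ u_lt) le; rewrite eE normC_nrm lecR.
  rewrite -(@ler_pM2r _ (nrm u)) ?nrm_gt0// (le_trans _ le)// -nrmM -nrmN.
  suff -> : - ((d - u^-1 *: (h (u + z) - h z)) * u) = h (u + z) - h z - d * u by [].
  by rewrite -mulNr -quotient_remainder.
apply/cvg_ex; exists d; move: cv.
suff -> : (fun u : R[i] => u^-1 *: ((h \o shift z) u%:A - h z)) =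
  (fun u => u^-1 *: (h (u + z) - h z)) by [].
by apply/funext => u /=; rewrite [u%:A]mulr1.
Qed.

Lemma differentiable_nrm_lt h z (e : R) : differentiable h z -> 0 < e ->
  exists2 d : R, 0 < d & forall w, nrm (w - z) < d -> nrm (h w - h z) < e.
Proof.
move=> /differentiable_continuous /cvgrPdist_lt /(_ e%:C%C).
rewrite ltcR => + e0 => /(_ e0) /nbhs_nrm[d d0 dP]; exists d => // w /dP.
by rewrite normC_nrm ltcR nrmBC.
Qed.

End ComplexDerivative.

(** * Trapezoid sums along segments and squares *)

Section TrapezoidSums.
Variable R : realType.
Implicit Types (h g : R[i] -> R[i]) (z a d w c : R[i]) (m : nat).

(** Trapezoid sum of [h] along the segment from [a] to [a + d], cut into [2 ^ m]
    equal parts; the recursion on [m] makes additivity under halving hold by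
    definition. *)
Fixpoint edge h m a d : R[i] :=
  if m is m'.+1 then edge h m' a (d / 2) + edge h m' (a + d / 2) (d / 2)
  else d * (h a + h (a + d)) / 2.

Lemma edgeD h g m a d :
  edge (fun z => h z + g z) m a d = edge h m a d + edge g m a d.
Proof. by elim: m a d => [|m IH] a d /=; [field | rewrite !IH; ring]. Qed.

Lemma edgeZ c h m a d : edge (fun z => c * h z) m a d = c * edge h m a d.
Proof. by elim: m a d => [|m IH] a d /=; [field | rewrite !IH; ring]. Qed.

(** The trapezoid rule is exact on affine functions. *)
Lemma edge_affine b c m a d :
  edge (fun z => b + c * z) m a d = d * (b + c * (a + d / 2)).
Proof. by elim: m a d => [|m IH] a d /=; [field | rewrite !IH; field]. Qed.

Lemma edge_reverse h m a d : edge h m (a + d) (- d) = - edge h m a d.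
Proof.
elim: m a d => [|m IH] a d /=; first by rewrite addrK; field.
have e1 : a + d - d / 2 = a + d / 2 by field.
have e2 : a + d = a + d / 2 + d / 2 by field.
by rewrite mulNr e1 {1}e2 !IH opprD addrC.
Qed.

Lemma edge_even h m a d : (forall z, h (- z) = h z) ->
  edge h m (- a) (- d) = - edge h m a d.
Proof.
move=> he; elim: m a d => [|m IH] a d /=; first by rewrite -opprD !he; field.
by rewrite mulNr -opprD !IH opprD.
Qed.

Lemma edge_bound h m a d (K : R) :
  (forall t : R, 0 <= t <= 1 -> nrm (h (a + t%:C%C * d)) <= K) ->
  nrm (edge h m a d) <= nrm d * K.
Proof.
have n2 : nrm (2 : R[i]) = 2 :> R by rewrite -[2]/(2%:R) -(rmorph_nat (real_complex R)) nrm_real normr_nat.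
elim: m a d => [|m IH] a d hK /=.
  rewrite !nrmM nrmV n2.
  have := hK 0; have := hK 1; rewrite rmorph0 rmorph1 mul0r mul1r addr0 !lexx !ler01 /=.
  move=> /(_ isT) h1 /(_ isT) h0.
  rewrite -mulrA ler_wpM2l ?nrm_ge0// ler_pdivrMr//.
  rewrite (le_trans (nrmD _ _))//; lra.
rewrite (le_trans (nrmD _ _))//.
have nd : nrm (d / 2) = nrm d / 2 by rewrite nrmM nrmV n2.
have -> : nrm d * K = nrm (d / 2) * K + nrm (d / 2) * K by rewrite nd; field.
apply: lerD; apply: IH => t t01.
  have -> : t%:C%C * (d / 2) = (t / 2)%:C%C * d.
    by rewrite [in RHS]rmorphM fmorphV rmorph_nat; field.
  by apply: hK; lra.
have -> : a + d / 2 + t%:C%C * (d / 2) = a + ((t + 1) / 2)%:C%C * d.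
  by rewrite [in RHS]rmorphM fmorphV rmorph_nat rmorphD rmorph1; field.
by apply: hK; lra.
Qed.

Lemma edge_Im h m a d (K : R) :
  (forall t : R, 0 <= t <= 1 -> K <= complex.Im (d * h (a + t%:C%C * d))) ->
  K <= complex.Im (edge h m a d).
Proof.
have Imhalf z : complex.Im (z / 2) = complex.Im z / 2.
  have -> : z / 2 = z * ((2^-1 : R)%:C)%C by rewrite fmorphV rmorph_nat.
  by case: z => x y; simpc.
elim: m a d K => [|m IH] a d K hK /=.
  have := hK 0; have := hK 1; rewrite rmorph0 rmorph1 mul0r mul1r addr0 !lexx !ler01 /=.
  move=> /(_ isT) h1 /(_ isT) h0.
  rewrite Imhalf mulrDr ImD; lra.
rewrite ImD.
have -> : K = K / 2 + K / 2 by field.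
apply: lerD; apply: IH => t t01; rewrite mulrAC Imhalf ler_pM2r//.
  have -> : t%:C%C * (d / 2) = (t / 2)%:C%C * d.
    by rewrite [in RHS]rmorphM fmorphV rmorph_nat; field.
  by apply: hK; lra.
have -> : a + d / 2 + t%:C%C * (d / 2) = a + ((t + 1) / 2)%:C%C * d.
  by rewrite [in RHS]rmorphM fmorphV rmorph_nat rmorphD rmorph1; field.
by apply: hK; lra.
Qed.

(** Trapezoid sum, counterclockwise along the boundary of the square with
    vertices [a], [a + d], [a + d + i d] and [a + i d]. *)
Definition contour h m a d : R[i] :=
  edge h m a d + edge h m (a + d) ('i%C * d)
  - edge h m (a + 'i%C * d) d - edge h m a ('i%C * d).

Lemma contourD h g m a d :
  contour (fun z => h z + g z) m a d = contour h m a d + contour g m a d.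
Proof. by rewrite /contour !edgeD; ring. Qed.

Lemma contourZ c h m a d : contour (fun z => c * h z) m a d = c * contour h m a d.
Proof. by rewrite /contour !edgeZ; ring. Qed.

Lemma contour_affine b c m a d : contour (fun z => b + c * z) m a d = 0.
Proof. by rewrite /contour !edge_affine; field. Qed.

(** The sums along the inner edges cancel exactly. *)
Lemma contourS h m a d : contour h m.+1 a d =
  contour h m a (d / 2) + contour h m (a + d / 2) (d / 2) +
  contour h m (a + 'i%C * (d / 2)) (d / 2) +
  contour h m (a + d / 2 + 'i%C * (d / 2)) (d / 2).
Proof.
rewrite /contour /=.
have -> : a + d / 2 + d / 2 = a + d by field.
have -> : 'i%C * d / 2 = 'i%C * (d / 2) by rewrite mulrA.
have -> : a + 'i%C * d + d / 2 = a + d / 2 + 'i%C * (d / 2) + 'i%C * (d / 2) by field.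
have -> : a + 'i%C * (d / 2) + 'i%C * (d / 2) = a + 'i%C * d by field.
have -> : a + 'i%C * (d / 2) + d / 2 = a + d / 2 + 'i%C * (d / 2) by ring.
have -> : a + d / 2 + 'i%C * (d / 2) + d / 2 = a + d + 'i%C * (d / 2) by field.
ring.
Qed.

End TrapezoidSums.

(** * Goursat's theorem for trapezoid sums *)

Section Goursat.
Variable R : realType.
Implicit Types (h : R[i] -> R[i]) (x y s u v : R) (m : nat).

(** Contour sum along the square [x, x + s] * [y, y + s], with sides parallel to
    the axes. *)
Definition square h m x y s : R[i] := contour h m (x +i* y)%C s%:C%C.

Lemma squareS h m x y s : square h m.+1 x y s =
  square h m x y (s / 2) + square h m (x + s / 2) y (s / 2) +
  square h m x (y + s / 2) (s / 2) + square h m (x + s / 2) (y + s / 2) (s / 2).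
Proof.
rewrite /square contourS.
have -> : (s%:C)%C / 2 = ((s / 2)%:C)%C :> R[i].
  by rewrite rmorphM fmorphV rmorph_nat.
have e1 a b c : (a +i* b)%C + (c%:C)%C = ((a + c) +i* b)%C :> R[i] by simpc.
have e2 a b c : (a +i* b)%C + 'i%C * (c%:C)%C = (a +i* (b + c))%C :> R[i] by simpc.
by rewrite !e1 !e2.
Qed.

(** Only the values on the boundary of the square matter. *)
Lemma square_bound h m x y s (K : R) : 0 <= s ->
  (forall u v, x <= u <= x + s -> y <= v <= y + s ->
     [\/ u = x, u = x + s, v = y | v = y + s] -> nrm (h (u +i* v)%C) <= K) ->
  nrm (square h m x y s) <= 4 * s * K.
Proof.
move=> s0 hK; rewrite /square /contour.
have ns : nrm (s%:C)%C = s by rewrite nrm_real ger0_norm.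
have nis : nrm ('i%C * (s%:C)%C) = s by rewrite nrmM nrm_i mul1r.
have tsP t : 0 <= t <= 1 -> 0 <= t * s <= s.
  by move=> /andP[t0 t1]; rewrite mulr_ge0// ler_piMl.
have B1 : nrm (edge h m (x +i* y)%C (s%:C)%C) <= s * K.
  rewrite -[X in _ <= X * _]ns; apply: edge_bound => t /tsP ts.
  have -> : (x +i* y)%C + (t%:C)%C * (s%:C)%C = ((x + t * s) +i* y)%C by simpc.
  by apply: hK; [lra|lra|exact: Or43].
have B2 : nrm (edge h m ((x +i* y)%C + (s%:C)%C) ('i%C * (s%:C)%C)) <= s * K.
  rewrite -[X in _ <= X * _]nis; apply: edge_bound => t /tsP ts.
  have -> : (x +i* y)%C + (s%:C)%C + (t%:C)%C * ('i%C * (s%:C)%C)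
    = ((x + s) +i* (y + t * s))%C by simpc.
  by apply: hK; [lra|lra|exact: Or42].
have B3 : nrm (edge h m ((x +i* y)%C + 'i%C * (s%:C)%C) (s%:C)%C) <= s * K.
  rewrite -[X in _ <= X * _]ns; apply: edge_bound => t /tsP ts.
  have -> : (x +i* y)%C + 'i%C * (s%:C)%C + (t%:C)%C * (s%:C)%C
    = ((x + t * s) +i* (y + s))%C by simpc.
  by apply: hK; [lra|lra|exact: Or44].
have B4 : nrm (edge h m (x +i* y)%C ('i%C * (s%:C)%C)) <= s * K.
  rewrite -[X in _ <= X * _]nis; apply: edge_bound => t /tsP ts.
  have -> : (x +i* y)%C + (t%:C)%C * ('i%C * (s%:C)%C) = (x +i* (y + t * s))%C by simpc.
  by apply: hK; [lra|lra|exact: Or41].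
have -> : 4 * s * K = s * K + s * K + s * K + s * K by ring.
rewrite (le_trans (nrmB _ _))// lerD// (le_trans (nrmB _ _))// lerD//.
by rewrite (le_trans (nrmD _ _))// lerD.
Qed.

(** Goursat's argument: on a small square around [z], [h] is within
    [e / 8 * nrm (w - z)] of an affine function, whose contour sum is zero. *)
Lemma goursat_eps h (e : R) x0 y0 s0 : 0 < e -> 0 < s0 ->
  (forall u v, x0 <= u <= x0 + s0 -> y0 <= v <= y0 + s0 ->
     differentiable h (u +i* v)%C) ->
  exists M, forall m, (M <= m)%N -> nrm (square h m x0 y0 s0) <= e * s0 ^+ 2.
Proof.
move=> e0 s0_gt0 dh.
pose P x y s := exists M, forall m, (M <= m)%N -> nrm (square h m x y s) <= e * s ^+ 2.
apply: (@square_bisection _ P) => //.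
  move=> x y s s_gt0 [M1 P1] [M2 P2] [M3 P3] [M4 P4].
  exists (M1 + M2 + M3 + M4).+1 => -[//|m]; rewrite ltnS => Mm; rewrite squareS.
  have {}P1 := P1 m (leq_trans _ Mm); have {}P2 := P2 m (leq_trans _ Mm).
  have {}P3 := P3 m (leq_trans _ Mm); have {}P4 := P4 m (leq_trans _ Mm).
  have -> : e * s ^+ 2 = e * (s / 2) ^+ 2 + e * (s / 2) ^+ 2 + e * (s / 2) ^+ 2
    + e * (s / 2) ^+ 2 by field.
  have le1 : (M1 <= M1 + M2 + M3 + M4)%N by lia.
  have le2 : (M2 <= M1 + M2 + M3 + M4)%N by lia.
  have le3 : (M3 <= M1 + M2 + M3 + M4)%N by lia.
  have le4 : (M4 <= M1 + M2 + M3 + M4)%N by lia.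
  rewrite (le_trans (nrmD _ _))// lerD ?P4// (le_trans (nrmD _ _))// lerD ?P3//.
  by rewrite (le_trans (nrmD _ _))// lerD ?P1 ?P2.
move=> a b ha hb; set z := (a +i* b)%C.
have e8 : 0 < e / 8 by rewrite divr_gt0.
have [d d0 dP] := differentiable_cderiv (dh a b ha hb) e8.
set D := derive1 h _ in dP.
exists (d / 2); first by rewrite divr_gt0.
move=> x y s s_gt0 sd ax bx; exists 0%N => m _.
pose g w := h w - (h z - D * z + D * w).
have -> : square h m x y s = square g m x y s.
  rewrite /square -[RHS]addr0 -(contour_affine (h z - D * z) D m (x +i* y)%C s%:C%C).
  rewrite -contourD; congr (contour _ _ _ _); apply/funext => w.
  by rewrite /g subrK.
have -> : e * s ^+ 2 = 4 * s * (e / 8 * (2 * s)) by field.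
apply: square_bound => [|u v us vs _]; first exact: ltW.
have near : nrm ((u +i* v)%C - z) <= 2 * s.
  rewrite (le_trans (nrm_le_ReIm _))// /z; simpc => /=.
  have : `|u - a| <= s by rewrite ler_norml; lra.
  have : `|v - b| <= s by rewrite ler_norml; lra.
  lra.
have -> : g (u +i* v)%C = h (u +i* v)%C - h z - D * ((u +i* v)%C - z).
  by rewrite /g; ring.
rewrite (le_trans (dP _ _))//; first by rewrite (le_lt_trans near)//; lra.
by rewrite ler_pM2l.
Qed.

(** Convergence to 0. *)
Definition vanishes (a : nat -> R[i]) := forall e : R, 0 < e ->
  exists M, forall m, (M <= m)%N -> nrm (a m) <= e.

Lemma vanishesD (a b : nat -> R[i]) :
  vanishes a -> vanishes b -> vanishes (fun m => a m + b m).
Proof.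
move=> va vb e e0; have e2 : 0 < e / 2 by rewrite divr_gt0.
have [M MP] := va _ e2; have [N NP] := vb _ e2.
exists (maxn M N) => m; rewrite geq_max => /andP[Mm Nm].
rewrite (le_trans (nrmD _ _))//; have := MP _ Mm; have := NP _ Nm; lra.
Qed.

Lemma goursat h x0 y0 s0 : 0 < s0 ->
  (forall u v, x0 <= u <= x0 + s0 -> y0 <= v <= y0 + s0 ->
     differentiable h (u +i* v)%C) ->
  vanishes (fun m => square h m x0 y0 s0).
Proof.
move=> s_gt0 dh e e0; have es : 0 < e / s0 ^+ 2 by rewrite divr_gt0// exprn_gt0.
have [M MP] := goursat_eps es s_gt0 dh; exists M => m /MP.
by rewrite divfK// expf_neq0// gt_eqF.
Qed.

(** A square centred at 0 minus the concentric square of half its side is the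
    union of twelve squares that avoid 0.  Two subdivisions of the former and
    one of the latter produce the same meshes, whence the shifts of [m]. *)
Lemma square_annulus h (p : R) : 0 < p ->
  (forall u v, `|u| <= p -> `|v| <= p -> (u, v) != (0, 0) ->
     differentiable h (u +i* v)%C) ->
  vanishes (fun m => square h m.+2 (- p) (- p) (2 * p)
                     - square h m.+1 (- (p / 2)) (- (p / 2)) (2 * (p / 2))).
Proof.
move=> p0 dh.
have van x y : - p <= x -> x + p / 2 <= p -> - p <= y -> y + p / 2 <= p ->
    [|| 0 < x, x + p / 2 < 0, 0 < y | y + p / 2 < 0] ->
    vanishes (fun m => square h m x y (p / 2)).
  move=> x1 x2 y1 y2 xy; apply: goursat => [|u v us vs]; first by rewrite divr_gt0.
  apply: dh; rewrite ?ler_norml; [lra|lra|].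
  rewrite xpair_eqE; apply/negP => /andP[/eqP u0 /eqP v0].
  by move: us vs xy; rewrite u0 v0 => us vs /or4P[] ?; lra.
pose S x y m := square h m x y (p / 2).
pose T m :=
    S (- p) (- p) m + S (- (p / 2)) (- p) m + S 0 (- p) m + S (p / 2) (- p) m
  + S (- p) (- (p / 2)) m + S (p / 2) (- (p / 2)) m
  + S (- p) 0 m + S (p / 2) 0 m
  + S (- p) (p / 2) m + S (- (p / 2)) (p / 2) m + S 0 (p / 2) m + S (p / 2) (p / 2) m.
have van_T : vanishes T.
  do 11 (apply: vanishesD; last by apply: van; try lra; apply/or4P;
    first [ by apply: Or41; lra | by apply: Or42; lra
          | by apply: Or43; lra | by apply: Or44; lra ]).
  by apply: van; try lra; apply/or4P; apply: Or42; lra.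
have TE m : square h m.+2 (- p) (- p) (2 * p)
    - square h m.+1 (- (p / 2)) (- (p / 2)) (2 * (p / 2)) = T m.
  have e1 : 2 * p / 2 / 2 = p / 2 by field.
  have e2 : 2 * (p / 2) / 2 = p / 2 by field.
  have e3 : - p + 2 * p / 2 = 0 by field.
  have e4 : - p + p / 2 = - (p / 2) by field.
  have e5 : - (p / 2) + p / 2 = 0 by field.
  by rewrite !squareS e1 e2 e3 e4 e5 add0r /T /S; ring.
move=> e e0; have [M MP] := van_T e e0; exists M => m /MP.
by rewrite TE.
Qed.

End Goursat.

(** * The Cauchy estimate *)

Section CauchyEstimate.
Variable R : realType.
Implicit Types (h k : R[i] -> R[i]) (z d w : R[i]) (p r u v a b e : R) (m : nat).

(** Shrinking the square towards a singularity at 0 does not change the limiting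
    size of the contour sums. *)
Lemma square_telescope k p e J : 0 < p ->
  (forall u v, `|u| <= p -> `|v| <= p -> (u, v) != (0, 0) ->
     differentiable k (u +i* v)%C) ->
  (exists M, forall m, (M <= m)%N ->
     nrm (square k m (- (p / 2 ^+ J)) (- (p / 2 ^+ J)) (2 * (p / 2 ^+ J))) <= e) ->
  forall e', e < e' -> exists M, forall m, (M <= m)%N ->
     nrm (square k m (- p) (- p) (2 * p)) <= e'.
Proof.
elim: J p e => [|J IH] p e p0 dk.
  rewrite expr0 divr1 => -[M MP] e' ee'; exists M => m /MP le; lra.
move=> small e' ee'.
have p2 : 0 < p / 2 by rewrite divr_gt0.
have [M MP] : exists M, forall m, (M <= m)%N ->
    nrm (square k m (- (p / 2)) (- (p / 2)) (2 * (p / 2))) <= (e + e') / 2.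
  apply: (IH _ e) => //; last 2 first.
  - have <- : p / 2 ^+ J.+1 = p / 2 / 2 ^+ J by rewrite exprS invfM mulrA.
    exact: small.
  - lra.
  by move=> u v ? ?; apply: dk; lra.
have e2 : 0 < (e' - e) / 2 by lra.
have [N NP] := square_annulus p0 dk e2.
exists (M + N).+2 => -[//|[//|m]] MNm.
have := NP m ltac:(lia); have := MP m.+1 ltac:(lia).
set A := square _ _ _ _ _; set B := square _ _ _ _ _ => hA hB.
have -> : B = (B - A) + A by rewrite subrK.
rewrite (le_trans (nrmD _ _))//; lra.
Qed.

Lemma Im_div_ge1 a b u v : 0 < u ^+ 2 + v ^+ 2 -> u ^+ 2 + v ^+ 2 <= b * u - a * v ->
  1 <= complex.Im ((a +i* b)%C * (u +i* v)%C^-1).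
Proof.
move=> n0 le.
have -> : complex.Im ((a +i* b)%C * (u +i* v)%C^-1) =
    (b * u - a * v) / (u ^+ 2 + v ^+ 2).
  have z0 : (u +i* v)%C != 0.
    by apply: contraTneq n0 => -[-> ->]; rewrite !expr0n addr0 ltxx.
  have -> : (u +i* v)%C^-1 = (u / (u ^+ 2 + v ^+ 2) -i* (v / (u ^+ 2 + v ^+ 2)))%C.
    by [].
  by simpc => /=; field; rewrite gt_eqF.
by rewrite ler_pdivlMr// mul1r.
Qed.

(** Each of the four edges contributes at least 1. *)
Lemma Im_square_inv_ge4 p m : 0 < p ->
  4 <= complex.Im (square (fun w => w^-1) m (- p) (- p) (2 * p)).
Proof.
move=> p0; rewrite /square /contour.
have sq u : - p <= u <= p -> u ^+ 2 <= p ^+ 2.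
  by rewrite -ler_norml => up; rewrite -real_normK ?num_real// ler_pXn2r ?nnegrE ?(ltW p0).
have pp : 0 < p ^+ 2 by rewrite exprn_gt0.
have opp h (a d : R[i]) : - edge h m a d = edge (fun z => -1 * h z) m a d.
  by rewrite edgeZ mulN1r.
have tP t : 0 <= t <= 1 -> - p <= - p + t * (2 * p) <= p.
  move=> /andP[t0 t1]; have : 0 <= t * (2 * p) by rewrite mulr_ge0//; lra.
  have : t * (2 * p) <= 2 * p by rewrite ler_piMl//; lra.
  lra.
rewrite !ImD -[4](_ : 1 + 1 + 1 + 1 = 4 :> R); last by ring.
rewrite !opp; apply: lerD; [apply: lerD; [apply: lerD|]|];
  apply: edge_Im => t /tP tp.
- have -> : ((- p) +i* (- p))%C + t%:C%C * (2 * p)%:C%C =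
    ((- p + t * (2 * p)) +i* (- p))%C by simpc.
  have := sq _ tp; set u := _ + _ => up; have := sqr_ge0 u => u0.
  by apply: Im_div_ge1; lra.
- have -> : ((- p) +i* (- p))%C + (2 * p)%:C%C + t%:C%C * ('i%C * (2 * p)%:C%C) =
    (p +i* (- p + t * (2 * p)))%C.
    by simpc; congr (_ +i* _)%C; ring.
  have := sq _ tp; set u := _ + _ => up; have := sqr_ge0 u => u0.
  have -> : 'i%C * (2 * p)%:C%C = (0 +i* (2 * p))%C :> R[i] by simpc.
  by apply: Im_div_ge1; lra.
- have -> : ((- p) +i* (- p))%C + 'i%C * (2 * p)%:C%C + t%:C%C * (2 * p)%:C%C =
    ((- p + t * (2 * p)) +i* p)%C.
    by simpc; congr (_ +i* _)%C; ring.
  have := sq _ tp; set u := _ + _ => up; have := sqr_ge0 u => u0.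
  have -> z : (2 * p)%:C%C * (-1 * z) = (- (2 * p) +i* 0)%C * z.
    by rewrite mulN1r mulrN -mulNr; congr (_ * _); simpc.
  by apply: Im_div_ge1; lra.
- have -> : ((- p) +i* (- p))%C + t%:C%C * ('i%C * (2 * p)%:C%C) =
    (- p +i* (- p + t * (2 * p)))%C by simpc.
  have := sq _ tp; set u := _ + _ => up; have := sqr_ge0 u => u0.
  have -> z : 'i%C * (2 * p)%:C%C * (-1 * z) = (0 +i* (- (2 * p)))%C * z.
    by rewrite mulN1r mulrN -mulNr; congr (_ * _); simpc.
  by apply: Im_div_ge1; lra.
Qed.

Lemma square_even_eq0 h m p : (forall z, h (- z) = h z) ->
  square h m (- p) (- p) (2 * p) = 0.
Proof.
move=> he; rewrite /square /contour.
set a := ((- p) +i* (- p))%C; set d := ((2 * p)%:C)%C.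
have e1 : edge h m (a + 'i%C * d) d = edge h m a d.
  have -> : a + 'i%C * d = - (a + d) by rewrite /a /d; simpc; congr (_ +i* _)%C; ring.
  by rewrite -[X in edge _ _ _ X = _]opprK edge_even// edge_reverse opprK.
have e2 : edge h m (a + d) ('i%C * d) = edge h m a ('i%C * d).
  have -> : a + d = - (a + 'i%C * d) by rewrite /a /d; simpc; congr (_ +i* _)%C; ring.
  by rewrite -[X in edge _ _ _ X = _]opprK edge_even// edge_reverse opprK.
by rewrite e1 e2; ring.
Qed.

Lemma nrm_square_ge p u v : 0 < p -> 
  [\/ u = - p, u = - p + 2 * p, v = - p | v = - p + 2 * p] ->
  p <= nrm (u +i* v)%C.
Proof.
move=> p0; have -> : - p + 2 * p = p by ring.
have np : p <= `|p| /\ p <= `|- p| by rewrite normrN gtr0_norm.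
by case=> ->; [ apply: le_trans (Re_le_nrm _) | apply: le_trans (Re_le_nrm _)
  | apply: le_trans (Im_le_nrm _) | apply: le_trans (Im_le_nrm _)] => /=; case: np.
Qed.

(** The Cauchy estimate at 0, with the square of half-side [r / 2], which is
    contained in the disc of radius [r]. *)
Lemma cauchy_estimate0 h r (K : R) d : 0 < r ->
  (forall w, nrm w < r -> differentiable h w) ->
  (forall w, nrm w < r -> nrm (h w) <= K) ->
  cderiv h 0 d -> nrm d <= 4 * K / r.
Proof.
move=> r0 dh hK h0.
pose p := r / 2; have p0 : 0 < p by rewrite divr_gt0.
have in_disc u v : `|u| <= p -> `|v| <= p -> nrm (u +i* v)%C < r.
  exact: nrm_lt_square.
(* k is o(1/w) at 0, so its contour sums are small on small squares, hence on
   the large one. *)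
pose k w := (h w - h 0 - d * w) * w ^- 2.
have dk u v : `|u| <= p -> `|v| <= p -> (u, v) != (0, 0) ->
    differentiable k (u +i* v)%C.
  move=> up vp uv0; apply: differentiableM; last first.
    apply: (@differentiableV _ _ (fun w : R[i] => w ^+ 2)).
      by under eq_fun do rewrite expr2; exact: differentiableM.
    by rewrite expf_eq0 /= eq_complex.
  apply: differentiableB; last exact: differentiableM.
  by apply: differentiableB; first exact/dh/in_disc.
have kvan e : 0 < e -> exists M, forall m, (M <= m)%N ->
    nrm (square k m (- p) (- p) (2 * p)) <= e.
  move=> e0; have e16 : 0 < e / 16 by lra.
  have [del del0 delP] := h0 _ e16.
  have [J JP] : exists J, p / 2 ^+ J < del / 2.
    have [J JP] : exists k : nat, p / (del / 2) < k%:R.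
      by exists (Num.truncn (p / (del / 2))).+1; exact: truncnS_gt.
    exists J; rewrite ltr_pdivrMr ?exprn_gt0//.
    rewrite ltr_pdivrMr ?divr_gt0// in JP; rewrite (lt_trans JP)// mulrC ltr_pM2l ?divr_gt0//.
    by rewrite -natrX ltr_nat ltn_expl.
  apply: (@square_telescope k p (e / 2) J) => //; last by lra.
  exists 0%N => m _; set q := p / 2 ^+ J in JP *.
  have q0 : 0 < q by rewrite divr_gt0 ?exprn_gt0.
  have -> : e / 2 = 4 * (2 * q) * (e / 16 / q) by field; rewrite gt_eqF.
  apply: square_bound => [|u v uq vq bd]; first lra.
  have := nrm_square_ge q0 bd.
  have : nrm (u +i* v)%C < del.
    rewrite (le_lt_trans (nrm_le_ReIm _))//=.
    have : `|u| <= q by rewrite ler_norml; lra.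
    have : `|v| <= q by rewrite ler_norml; lra.
    lra.
  set z := (u +i* v)%C => zdel qz; have := delP z; rewrite subr0 => /(_ zdel) le.
  have z0 : 0 < nrm z by rewrite (lt_le_trans q0).
  rewrite /k nrmM nrmV nrmX ler_pdivrMr ?exprn_gt0// (le_trans le)//.
  have -> : e / 16 / q * nrm z ^+ 2 = e / 16 * (nrm z * (nrm z / q)).
    by field; rewrite gt_eqF.
  by rewrite ler_pM2l// ler_peMr ?(ltW z0)// ler_pdivlMr// mul1r.
(* The contour sums of h w / w^2 exceed those of k by d times those of 1/w. *)
pose g w := h w * w ^- 2.
(* This also holds at w = 0, where every term is 0 because 0^-1 = 0. *)
have gE w : g w = k w + (h 0 * w ^- 2 + d * w^-1).
  rewrite /g /k; have [->|w0] := eqVneq w 0; last by field.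
  by rewrite expr0n invr0 !mulr0 !addr0.
have gb m : nrm (square g m (- p) (- p) (2 * p)) <= 8 * K / p.
  have -> : 8 * K / p = 4 * (2 * p) * (K / p ^+ 2) by field; rewrite gt_eqF.
  apply: square_bound => [|u v up vp bd]; first lra.
  have pz := nrm_square_ge p0 bd.
  have /hK hz : nrm (u +i* v)%C < r by apply: in_disc; rewrite ler_norml; lra.
  rewrite /g nrmM nrmV nrmX ler_pM ?nrm_ge0 ?invr_ge0 ?exprn_ge0 ?nrm_ge0//.
  rewrite lef_pV2 ?posrE ?exprn_gt0// ?(lt_le_trans p0 pz)//.
  by rewrite ler_pXn2r ?nnegrE ?nrm_ge0// ltW.
have sqgE m : square g m (- p) (- p) (2 * p) = square k m (- p) (- p) (2 * p) +
    d * square (fun w => w^-1) m (- p) (- p) (2 * p).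
  rewrite /square -contourZ -contourD.
  have -> : g = (fun z => (k z + d * z^-1) + h 0 * z ^- 2).
    by apply/funext => w; rewrite gE addrAC addrA.
  rewrite (contourD (fun z => k z + d * z^-1) (fun z => h 0 * z ^- 2)).
  rewrite (contourZ (h 0) (fun z => z ^- 2)).
  have := @square_even_eq0 (fun z => z ^- 2) m p; rewrite /square => -> //.
    by rewrite mulr0 addr0.
  by move=> z; rewrite sqrrN.
have -> : 4 * K / r = (8 * K / p) / 4 by rewrite /p; field; rewrite gt_eqF.
apply/ler_addgt0Pr => e e0.
have e4 : 0 < 4 * e by lra.
have [M MP] := kvan _ e4; have := MP M (leqnn _); have := gb M.
have := Im_square_inv_ge4 M p0; have := Im_le_nrm (square (fun w => w^-1) M (- p) (- p) (2 * p)).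
rewrite ler_norml => /andP[_]; move: (sqgE M).
set A := square g _ _ _ _; set B := square k _ _ _ _; set I := square _ _ _ _ _.
move=> AE le1 le2 hA hB.
have : nrm (d * I) <= nrm A + nrm B.
  by have -> : d * I = A - B by [rewrite AE addrC addKr]; exact: nrmB.
rewrite nrmM => le3.
have : nrm d * 4 <= nrm d * nrm I by rewrite ler_wpM2l ?nrm_ge0// (le_trans le2).
lra.
Qed.

Lemma cauchy_estimate h z r (K : R) d : 0 < r ->
  (forall w, nrm (w - z) < r -> differentiable h w) ->
  (forall w, nrm (w - z) < r -> nrm (h w) <= K) ->
  cderiv h z d -> nrm d <= 4 * K / r.
Proof.
move=> r0 dh hK hz; apply: (@cauchy_estimate0 (fun w => h (w + z))) => //.
- move=> w wr; apply: (@differentiable_comp _ _ _ _ (fun w => w + z) h) => //.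
  by apply: dh; rewrite addrK.
- by move=> w wr; apply: hK; rewrite addrK.
move=> e /hz[del del0 delP]; exists del => // w; rewrite subr0 add0r => wd.
by have := delP (w + z); rewrite addrK; exact.
Qed.

End CauchyEstimate.

(** * Bounded and nonvanishing holomorphic functions on a disc *)

Section Nonvanishing.
Variable R : realType.
Implicit Types (h g q : R[i] -> R[i]) (z d w : R[i]) (r x y s t e : R).

(** The Cauchy estimate on discs of radius [r / 2] bounds the derivative by
    [8 / r]; bisection of the segment from 0 to [w] turns this into a Lipschitz
    bound, with a slightly larger constant. *)
Lemma lipschitz_bounded h r w : 0 < r ->
  (forall z, nrm z < r -> differentiable h z) ->
  (forall z, nrm z < r -> nrm (h z) <= 1) ->
  nrm w < r / 2 -> nrm (h w - h 0) <= 9 / r * nrm w.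
Proof.
move=> r0 dh h1 wr.
(* Only the horizontal coordinate x, x + s, which parametrizes the segment, is
   used; y is a dummy. *)
pose P x (y : R) s := nrm (h ((x + s)%:C%C * w) - h (x%:C%C * w)) <= 9 / r * (s * nrm w).
suff : P 0 0 1 by rewrite /P add0r rmorph0 rmorph1 !mul1r mul0r.
apply: (@square_bisection _ P) => //.
  rewrite /P => x y s s0 P1 P2 _ _.
  have -> : 9 / r * (s * nrm w) = 9 / r * (s / 2 * nrm w) + 9 / r * (s / 2 * nrm w).
    by field; rewrite gt_eqF.
  have e : x + s = x + s / 2 + s / 2 by field.
  set A := h _; set B := h (x%:C%C * w).
  have -> : A - B = (A - h ((x + s / 2)%:C%C * w)) + (h ((x + s / 2)%:C%C * w) - B).
    by rewrite addrA subrK.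
  by rewrite (le_trans (nrmD _ _))// lerD// /A e.
move=> a b /andP[a0 a1] _; set z := a%:C%C * w.
have zr : nrm z < r / 2.
  by rewrite nrmM nrm_real ger0_norm// (le_lt_trans _ wr)// ler_piMl ?nrm_ge0//; lra.
have dz : differentiable h z by apply: dh; lra.
have near u : nrm (u - z) < r / 2 -> nrm u < r.
  move=> ur; rewrite -[u](subrK z) (le_lt_trans (nrmD _ _))//; lra.
have D8 : nrm (derive1 h z) <= 4 * 1 / (r / 2).
  apply: (@cauchy_estimate _ h z); first by lra.
  - by move=> u /near /dh.
  - by move=> u /near /h1.
  exact: differentiable_cderiv.
have {}D8 : nrm (derive1 h z) <= 8 / r.
  by rewrite (le_trans D8)// le_eqVlt; apply/orP; left; apply/eqP; field; rewrite gt_eqF.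
have r1 : 0 < 1 / r by rewrite divr_gt0.
have [del del0 delP] := differentiable_cderiv dz r1.
have lip u : nrm (u - z) < del -> nrm (h u - h z) <= 9 / r * nrm (u - z).
  move=> /delP le; rewrite -[h u - h z](subrK (derive1 h z * (u - z))).
  rewrite (le_trans (nrmD _ _))// nrmM.
  have -> : 9 / r * nrm (u - z) = 1 / r * nrm (u - z) + 8 / r * nrm (u - z).
    by field; rewrite gt_eqF.
  by rewrite lerD// ler_wpM2r ?nrm_ge0.
have w1 : 0 < nrm w + 1 by have := nrm_ge0 w; lra.
exists (del / (nrm w + 1)); first by rewrite divr_gt0.
move=> x y s s0; rewrite ltr_pdivlMr// => sd /andP[xa axs] _.
have scal t : nrm (t%:C%C * w - z) = `|t - a| * nrm w.
  by rewrite /z -mulrBl -rmorphB nrmM nrm_real.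
have sw : s * nrm w < del.
  by rewrite (le_lt_trans _ sd)// ler_wpM2l ?ltW//; lra.
have hx : nrm (h ((x + s)%:C%C * w) - h z) <= 9 / r * ((x + s - a) * nrm w).
  have := @lip ((x + s)%:C%C * w); rewrite scal ger0_norm; last lra.
  apply; rewrite (le_lt_trans _ sw)// ler_wpM2r ?nrm_ge0//; lra.
have hy : nrm (h (x%:C%C * w) - h z) <= 9 / r * ((a - x) * nrm w).
  have := @lip (x%:C%C * w); rewrite scal ler0_norm ?opprB; last lra.
  apply; rewrite (le_lt_trans _ sw)// ler_wpM2r ?nrm_ge0//; lra.
rewrite /P.
have -> : h ((x + s)%:C%C * w) - h (x%:C%C * w) =
  (h ((x + s)%:C%C * w) - h z) - (h (x%:C%C * w) - h z) by ring.
have -> : 9 / r * (s * nrm w) =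
  9 / r * ((x + s - a) * nrm w) + 9 / r * ((a - x) * nrm w) by ring.
by rewrite (le_trans (nrmB _ _))// lerD.
Qed.

Lemma Re_sqrtc_ge0 z : 0 <= complex.Re (sqrtc z).
Proof. by case: z => a b /=; exact: sqrtr_ge0. Qed.

Lemma Re_sqrtc_gt0 z : 0 < complex.Re z -> 0 < complex.Re (sqrtc z).
Proof.
case: z => a b /= a0; rewrite sqrtr_gt0 divr_gt0// ltr_wpDl// sqrtr_ge0//.
Qed.

(** The principal square root [sqrtc] has nonnegative real part, so that
    [sqrtc (q w) + sqrtc (q z)] stays away from 0, and the identity
    [q w - q z = (sqrtc (q w) - sqrtc (q z)) * (sqrtc (q w) + sqrtc (q z))]
    gives both continuity and differentiability. *)
Lemma differentiable_sqrtc q z : differentiable q z -> 0 < complex.Re (q z) ->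
  differentiable (fun w => sqrtc (q w)) z.
Proof.
move=> dq /Re_sqrtc_gt0; set c := complex.Re _ => c0.
pose S w := sqrtc (q w); set D := derive1 q z; set L := nrm D + 1.
have L0 : 0 < L by have := nrm_ge0 D; rewrite /L; lra.
have cS : c <= nrm (S z) by rewrite (le_trans _ (Re_le_nrm _))// ler_norm.
have S0 : S z != 0 by rewrite -nrm_gt0 (lt_le_trans c0).
have S2 w : S w ^+ 2 = q w by exact: sqr_sqrtc.
have Sle w : nrm (S w - S z) <= nrm (q w - q z) / c.
  rewrite ler_pdivlMr//.
  have -> : q w - q z = (S w - S z) * (S w + S z) by rewrite -!S2; ring.
  rewrite nrmM ler_wpM2l ?nrm_ge0// (le_trans _ (Re_le_nrm _))//.
  by rewrite ReD (le_trans _ (ler_norm _))// lerDr Re_sqrtc_ge0.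
apply: (@cderiv_differentiable _ S z (D / (2 * S z))) => e e0.
have [d1 d1_gt0 d1P] := differentiable_cderiv dq (@ltr01 R).
have ec : 0 < e * c by rewrite mulr_gt0.
have [d2 d2_gt0 d2P] := differentiable_cderiv dq ec.
have d3_gt0 : 0 < e * c ^+ 3 / L ^+ 2 by rewrite divr_gt0 ?mulr_gt0 ?exprn_gt0.
exists (Num.min d1 (Num.min d2 (e * c ^+ 3 / L ^+ 2))); first by rewrite !lt_min d1_gt0 d2_gt0.
move=> w; rewrite !lt_min => /and3P[/d1P w1 /d2P w2 w3].
have {}w1 : nrm (q w - q z) <= L * nrm (w - z).
  rewrite -[q w - q z](subrK (D * (w - z))) (le_trans (nrmD _ _))// nrmM /L.
  by rewrite mulrDl addrC lerD2l.
have -> : S w - S z - D / (2 * S z) * (w - z) =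
    ((q w - q z - D * (w - z)) - (S w - S z) ^+ 2) / (2 * S z).
  by rewrite -!S2; field.
have n2 : nrm (2 : R[i]) = 2 :> R.
  by rewrite -(rmorph_nat (real_complex R)) nrm_real normr_nat.
rewrite nrmM nrmV nrmM n2 ler_pdivrMr; last by rewrite mulr_gt0// nrm_gt0.
rewrite (le_trans (nrmB _ _))// nrmX.
apply: (@le_trans _ _ (e * nrm (w - z) * (2 * c))); last first.
  by apply: ler_wpM2l; rewrite ?ler_pM2l// mulr_ge0 ?nrm_ge0// ltW.
have -> : e * nrm (w - z) * (2 * c) = e * c * nrm (w - z) + e * c * nrm (w - z) by ring.
rewrite lerD//.
have le1 : nrm (S w - S z) <= L * nrm (w - z) / c.
  by rewrite (le_trans (Sle w))// ler_wpM2r// invr_ge0 ltW.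
have rhs0 : 0 <= L * nrm (w - z) / c.
  by apply: divr_ge0; [apply: mulr_ge0; [exact: ltW|exact: nrm_ge0]|exact: ltW].
apply: (@le_trans _ _ ((L * nrm (w - z) / c) ^+ 2)).
  by rewrite ler_pXn2r ?nnegrE ?nrm_ge0.
have -> : (L * nrm (w - z) / c) ^+ 2 = nrm (w - z) * (L ^+ 2 / c ^+ 2) * nrm (w - z).
  by field; rewrite gt_eqF.
rewrite ler_wpM2r ?nrm_ge0//.
have -> : e * c = e * c ^+ 3 / L ^+ 2 * (L ^+ 2 / c ^+ 2).
  by field; rewrite !gt_eqF.
by apply: ler_wpM2r; [apply: divr_ge0; apply: exprn_ge0; exact: ltW|exact: ltW].
Qed.

(** By compactness, [g w / g z] is within distance 1 of 1 as soon as [w] and [z]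
    are uniformly close. *)
Lemma uniform_ratio g r : 0 < r ->
  (forall w, nrm w < r -> differentiable g w) ->
  (forall w, nrm w < r -> g w != 0) ->
  exists2 e : R, 0 < e & forall z w, nrm z < r / 2 -> nrm (w - z) < e ->
    nrm (g w - g z) < nrm (g z).
Proof.
move=> r0 dg g0; set p := r / 2; have p0 : 0 < p by rewrite divr_gt0.
pose P x y s := exists2 e : R, 0 < e & forall u v w,
  x <= u <= x + s -> y <= v <= y + s ->
  nrm (w - (u +i* v)%C) < e -> nrm (g w - g (u +i* v)%C) < nrm (g (u +i* v)%C).
suff [e e0 eP] : P (- p) (- p) (2 * p).
  exists e => // -[u v] w zp; apply: eP => //.
    have : `|u| <= nrm (u +i* v)%C := Re_le_nrm (u +i* v)%C; rewrite ler_norml; lra.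
  have : `|v| <= nrm (u +i* v)%C := Im_le_nrm (u +i* v)%C; rewrite ler_norml; lra.
apply: (@square_bisection _ P); last by lra.
  move=> x y s s0 [e1 e10 P1] [e2 e20 P2] [e3 e30 P3] [e4 e40 P4].
  exists (Num.min (Num.min e1 e2) (Num.min e3 e4)).
    by rewrite !lt_min e10 e20 e30 e40.
  move=> u v w us vs; rewrite !lt_min => /andP[/andP[w1 w2] /andP[w3 w4]].
  have [ux|ux] := leP u (x + s / 2); have [vy|vy] := leP v (y + s / 2).
  - by apply: P1 => //; lra.
  - by apply: P3 => //; lra.
  - by apply: P2 => //; lra.
  - by apply: P4 => //; lra.
move=> a b ap bp; set z := (a +i* b)%C.
have zr : nrm z < r.
  by apply: nrm_lt_square; rewrite // -/p ler_norml; lra.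
have gz : 0 < nrm (g z) / 4 by rewrite divr_gt0// nrm_gt0 g0.
have [d d0 dP] := differentiable_nrm_lt (dg z zr) gz.
exists (d / 4); first by rewrite divr_gt0.
move=> x y s s0 sd ax bx; exists (d / 2); first by rewrite divr_gt0.
move=> u v w us vs wd; set z' := (u +i* v)%C in wd *.
have zz' : nrm (z' - z) < d / 2.
  rewrite (le_lt_trans (nrm_le_ReIm _))// /z /z'; simpc => /=.
  have : `|u - a| <= s by rewrite ler_norml; lra.
  have : `|v - b| <= s by rewrite ler_norml; lra.
  lra.
have h1 := dP z' ltac:(lra).
have h2 : nrm (g w - g z) < nrm (g z) / 4.
  apply: dP; have := nrmD (w - z') (z' - z); rewrite addrA subrK; lra.
have := nrmB (g w - g z) (g z' - g z).
have -> : g w - g z - (g z' - g z) = g w - g z' by ring.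
have := nrmB (g z') (g z' - g z).
have -> : g z' - (g z' - g z) = g z by ring.
lra.
Qed.

(** Halving the radius provides the room needed for the compactness
    argument. *)
Lemma holomorphic_sqrt g r : 0 < r ->
  (forall w, nrm w < r -> differentiable g w) ->
  (forall w, nrm w < r -> g w != 0) ->
  exists G : R[i] -> R[i], forall w, nrm w < r / 2 ->
    differentiable G w /\ G w ^+ 2 = g w.
Proof.
move=> r0 dg g0; have [e e0 eP] := uniform_ratio r0 dg g0.
set p := r / 2; have p0 : 0 < p by rewrite divr_gt0.
pose N := (Num.truncn (p / e)).+1.
have N0 : 0 < N%:R :> R by rewrite ltr0n.
have pN : p / N%:R < e.
  by rewrite ltr_pdivrMr// mulrC -ltr_pdivrMr//; exact: truncnS_gt.
pose c j : R[i] := ((j%:R / N%:R : R)%:C)%C.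
(* F j is a square root of w |-> g (c j * w), and c N = 1. *)
pose F := fix F j w := if j is j'.+1 then
  F j' w * sqrtc (g (c j'.+1 * w) / g (c j' * w)) else sqrtc (g 0).
have cj j w : (j <= N)%N -> nrm w < p -> nrm (c j * w) < p.
  move=> jN wp; rewrite nrmM nrm_real ger0_norm ?divr_ge0// (le_lt_trans _ wp)//.
  by rewrite ler_piMl ?nrm_ge0// ler_pdivrMr// mul1r ler_nat.
have pr w : nrm w < p -> nrm w < r by rewrite /p; lra.
have diffc j w : (j <= N)%N -> nrm w < p -> differentiable (fun w => g (c j * w)) w.
  move=> jN wp; apply: (@differentiable_comp _ _ _ _ (fun w => c j * w) g).
    exact: differentiableM.
  exact/dg/pr/cj.
have FP j : (j <= N)%N -> forall w, nrm w < p ->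
    differentiable (F j) w /\ F j w ^+ 2 = g (c j * w).
  elim: j => [|j IH] jN w wp.
    split; first exact: differentiable_cst.
    by rewrite /= sqr_sqrtc /c mul0r rmorph0 mul0r.
  have [dF F2] := IH (ltnW jN) w wp.
  have gj0 : g (c j * w) != 0 by apply/g0/pr/cj => //; exact: ltnW.
  split; last by rewrite /= exprMn F2 sqr_sqrtc mulrC divfK.
  apply: (@differentiableM _ _ (F j)) => //.
  apply: (@differentiable_sqrtc (fun w => g (c j.+1 * w) / g (c j * w))).
    apply: differentiableM; first exact: diffc.
    by apply: (@differentiableV _ _ (fun w => g (c j * w))) => //; apply/diffc/wp/ltnW.
  have close : nrm (g (c j.+1 * w) / g (c j * w) - 1) < 1.
    rewrite -[X in _ - X](mulfV gj0) -mulrBl nrmM nrmV ltr_pdivrMr ?nrm_gt0// mul1r.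
    apply: eP; first by apply: cj => //; exact: ltnW.
    have -> : c j.+1 * w - c j * w = ((N%:R^-1 : R)%:C)%C * w.
      rewrite -mulrBl /c -rmorphB; congr (_%:C%C * _).
      by rewrite -mulrBl -natrB// subSnn mul1r.
    rewrite nrmM nrm_real ger0_norm ?invr_ge0 ?ltW// (lt_trans _ pN)// mulrC.
    by rewrite ltr_pM2r// invr_gt0.
  have := le_lt_trans (Re_le_nrm _) close; rewrite ReD ltr_norml /=; lra.
exists (F N) => w wp; have [dF F2] := FP N (leqnn _) w wp; split=> //.
by rewrite F2 /c divff ?rmorph1 ?mul1r// gt_eqF.
Qed.

Lemma div_pow2_le k x : 0 < x -> x / 2 ^+ k <= x.
Proof.
move=> x0; rewrite ler_pdivrMr ?exprn_gt0// ler_peMr ?(ltW x0)//.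
by rewrite exprn_ege1// ler1n.
Qed.

Lemma holomorphic_root k g r : 0 < r ->
  (forall w, nrm w < r -> differentiable g w) ->
  (forall w, nrm w < r -> g w != 0) ->
  exists G : R[i] -> R[i], forall w, nrm w < r / 2 ^+ k ->
    differentiable G w /\ G w ^+ (2 ^ k) = g w.
Proof.
elim: k g r => [|k IH] g r r0 dg g0.
  by exists g => w; rewrite expr0 divr1 => wr; split; [exact: dg | rewrite expr1].
have [S SP] := holomorphic_sqrt r0 dg g0.
have r2 : 0 < r / 2 by rewrite divr_gt0.
have dS w : nrm w < r / 2 -> differentiable S w by move=> /SP[].
have S0 w : nrm w < r / 2 -> S w != 0.
  by move=> wr; have [_ S2] := SP w wr; rewrite -sqrf_eq0 S2 g0//; lra.
have [G GP] := IH S _ r2 dS S0.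
have rE : r / 2 ^+ k.+1 = r / 2 / 2 ^+ k by rewrite exprS invfM mulrA.
exists G => w; rewrite rE => wr; have [dG G2] := GP w wr; split=> //.
have [|_ <-] := SP w.
  exact: lt_le_trans wr (div_pow2_le k r2).
by rewrite expnSr exprM G2.
Qed.

(** A Harnack-type inequality: a lower bound for [g 0] propagates to a disc whose
    radius depends only on [k] and [r]. *)
Lemma nonvanishing_lower_bound k g r w : 0 < r ->
  (forall w, nrm w < r -> differentiable g w) ->
  (forall w, nrm w < r -> g w != 0) ->
  (forall w, nrm w < r -> nrm (g w) <= 1) ->
  (3 / 4) ^+ (2 ^ k) <= nrm (g 0) ->
  nrm w < r / 2 ^+ k / 36 -> (1 / 2) ^+ (2 ^ k) <= nrm (g w).
Proof.
move=> r0 dg g0 g1 gk wr.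
have [G GP] := holomorphic_root k r0 dg g0.
set p := r / 2 ^+ k in GP wr *.
have p0 : 0 < p by rewrite divr_gt0 ?exprn_gt0.
have pr : p <= r by exact: div_pow2_le.
have k0 : (0 < 2 ^ k)%N by rewrite expn_gt0.
have G1 z : nrm z < p -> nrm (G z) <= 1.
  move=> zp; have [_ GE] := GP z zp; rewrite -(@expr_le1 _ (2 ^ k)%N) ?nrm_ge0//.
  by rewrite -nrmX GE g1// (lt_le_trans zp).
have G0 : 3 / 4 <= nrm (G 0).
  have [|_ GE] := GP 0; first by rewrite Normc.normc0.
  by rewrite -(@ler_pXn2r _ (2 ^ k)%N) ?nnegrE ?nrm_ge0 ?divr_ge0// -nrmX GE.
have lip : nrm (G w - G 0) <= 9 / p * nrm w.
  apply: lipschitz_bounded => //; last lra.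
  by move=> z /GP[].
have {}lip : nrm (G w - G 0) <= 1 / 4.
  rewrite (le_trans lip)//.
  have -> : 1 / 4 = 9 / p * (p / 36) by field; rewrite gt_eqF.
  by rewrite ler_wpM2l ?divr_ge0 ?ltW.
have Gw : 1 / 2 <= nrm (G w).
  have := nrmB (G w) (G w - G 0); rewrite opprB addrCA subrr addr0; lra.
have [|_ <-] := GP w; first lra.
by rewrite nrmX ler_pXn2r ?nnegrE ?nrm_ge0 ?divr_ge0.
Qed.

End Nonvanishing.

(** * Hyperbolicity *)

Section Kobayashi.
Variable R : realType.

(** The derivative of a curve is computed coordinatewise. *)
Lemma derive1_coord n (phi : R[i] -> 'rV[R[i]]_n) z i : differentiable phi z ->
  derive1 (fun w => phi w 0 i : R[i]) z = derive1 phi z 0 i.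
Proof.
move=> dphi; have dcoord := differentiable_coord (phi z) 0 i.
have @c : {linear 'rV[R[i]]_n -> R[i]}.
  by exists (fun N : 'rV[R[i]]_n => N 0 i); do 2![eexists]; do ?[constructor];
     rewrite ?mxE// => ? *; rewrite ?mxE//; move=> ?; rewrite !mxE.
rewrite !derive1E'//; last first.
  exact: (@differentiable_comp _ _ _ _ phi (fun N : 'rV[R[i]]_n => N 0 i)).
have -> : 'd (fun w => phi w 0 i : R[i]) z = c \o 'd phi z :> (R[i] -> R[i]).
  rewrite (_ : (fun w => _) = c \o phi)// diff_comp// diff_lin//.
  exact: coord_continuous.
by [].
Qed.

Lemma nrm_le_enorm n (z : 'rV[R[i]]_n) i : nrm (z 0 i) <= enorm z.
Proof.
rewrite -[nrm _]ger0_norm ?nrm_ge0// -sqrtr_sqr ler_wsqrtr//.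
by rewrite (bigD1 i)//= lerDl sumr_ge0// => j _; rewrite sqr_ge0.
Qed.

Lemma enorm_le n (z : 'rV[R[i]]_n) (K : R) : 0 <= K ->
  (forall i, nrm (z 0 i) <= K) -> enorm z <= n%:R * K.
Proof.
move=> K0 zK; rewrite /enorm.
have nK : 0 <= n%:R * K by rewrite mulr_ge0.
rewrite -(ger0_norm nK) -sqrtr_sqr ler_wsqrtr//.
apply: (@le_trans _ _ (\sum_(i < n) K ^+ 2)).
  by apply: ler_sum => i _; rewrite ler_pXn2r ?nnegrE ?nrm_ge0.
rewrite sumr_const card_ord -[leLHS]mulr_natl exprMn ler_wpM2r ?sqr_ge0//.
by rewrite -natrX ler_nat; case: (n) => // m; rewrite -mulnn leq_pmulr.
Qed.

Lemma pow2_small (x d : R) : 0 <= x -> x < 1 -> 0 < d -> exists k, x ^+ (2 ^ k) <= d.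
Proof.
move=> x0 x1 d0; have : `|x| < 1 by rewrite ger0_norm.
move=> /cvg_expr /cvgrPdist_le /(_ _ d0)[k _ kP]; exists k.
have := kP k (leqnn _); rewrite sub0r normrN ger0_norm ?exprn_ge0//.
by apply: le_trans; rewrite ler_wiXn2l ?(ltW x1)// ltnW// ltn_expl.
Qed.

End Kobayashi.

Theorem corollary1 (R : realType) (n : nat) (Omega : set 'rV[R[i]]_n)
    (domOmega : domain Omega) (unbOmega : ~ bounded_set Omega)
    (f : 'rV[R[i]]_n -> R[i])
    (holf : holomorphic_on Omega f)
    (bndf : [bounded f z | z in Omega])
    (fneq0 : forall z, Omega z -> f z != 0)
    (f0 : f @ within Omega (@at_infinity R n) --> (0 : R[i])) :
  kobayashi_hyperbolic Omega.
Proof.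
move=> p Op; case: domOmega => openOmega _ _.
(* B bounds |f| on Omega. *)
have [B B0 fB] : exists2 B : R, 0 < B & forall z, Omega z -> nrm (f z) <= B.
  have [M M0 MP] := pinfty_ex_gt0 bndf.
  have ME : M = (complex.Re M)%:C%C by rewrite RRe_real// gtr0_real.
  exists (complex.Re M); first by rewrite -ltcR -ME.
  by move=> z /MP; rewrite /= ME normC_nrm lecR.
have fp : 0 < nrm (f p) / 2 by rewrite divr_gt0// nrm_gt0 fneq0.
pose U := Omega `&` [set z | nrm (f p) / 2 <= nrm (f z)].
have nbhsU : nbhs p U.
  apply: filterI; first exact: open_nbhs_nbhs.
  have := differentiable_continuous (holf p Op).
  move=> /cvgrPdist_lt /(_ (nrm (f p) / 2)%:C%C); rewrite ltcR => /(_ fp).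
  apply: filterS => z /=; rewrite normC_nrm ltcR => lt.
  by have := nrmD (f p - f z) (f z); rewrite subrK; lra.
have d0 : 0 < nrm (f p) / 2 / B by rewrite divr_gt0.
have [k kP] := @pow2_small R (3 / 4) _ ltac:(lra) ltac:(lra) d0.
(* d' bounds |f o phi| / B from below on the smaller disc; outside of a ball of
   radius A, |f| < B * d'. *)
pose d' : R := (1 / 2) ^+ (2 ^ k).
have d'0 : 0 < d' by rewrite exprn_gt0// divr_gt0.
have [A AP] : exists A, forall z, Omega z -> B * d' <= nrm (f z) -> enorm z <= A.
  have : nbhs (0 : R[i]) [set w | nrm w < B * d'].
    apply/nbhs_nrm; exists (B * d'); first by rewrite mulr_gt0.
    by move=> w; rewrite subr0.
  move=> /f0 [A _ AP]; exists A => z Oz; rewrite leNgt => /negP fz.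
  by rewrite leNgt; apply/negP => Az; apply: fz; exact: AP.
(* n * 4 |A| / r1 bounds the norm of phi'(0), where r1 = r / 2^k / 36; adding 1
   makes Q positive. *)
pose Q := n%:R * (4 * `|A| * (2 ^+ k * 36)) + 1.
have Q0 : 0 < Q by rewrite ltr_wpDl// !mulr_ge0// exprn_ge0.
exists U, Q^-1; split => //; [by move=> z [] | by rewrite invr_gt0 |].
move=> z v [Oz fz]; apply: le_ereal_inf_tmp => _ [r [r0 [phi [hol im phi0 dphi]]] <-].
rewrite lee_fin.
have Ophi w : nrm w < r -> Omega (phi w) by move=> wr; apply: im; exists w.
pose g w := f (phi w) / (B%:C)%C.
have BC0 : ((B%:C)%C : R[i]) != 0 by rewrite -nrm_gt0 nrm_real ger0_norm ?ltW.
have gE w : nrm (g w) = nrm (f (phi w)) / B.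
  by rewrite nrmM nrmV nrm_real gtr0_norm.
have dg w : nrm w < r -> differentiable g w.
  move=> wr; apply: (@differentiableM _ _ (fun w => f (phi w)) (fun=> (B%:C)%C^-1)).
    exact: (@differentiable_comp _ _ _ _ phi f _ (hol _ wr) (holf _ (Ophi _ wr))).
  exact: differentiable_cst.
pose r1 := r / 2 ^+ k / 36.
have r10 : 0 < r1 by rewrite !divr_gt0// exprn_gt0.
have r1r w : nrm w < r1 -> nrm w < r.
  move=> /lt_le_trans; apply; rewrite (le_trans _ (div_pow2_le k r0))// /r1.
  by rewrite ler_piMr ?(ltW (divr_gt0 r0 _)) ?exprn_gt0//; lra.
have phiA w : nrm w < r1 -> enorm (phi w) <= A.
  move=> wr; have wr' := r1r _ wr; apply: AP; first exact: Ophi.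
  have : d' <= nrm (g w).
    apply: (@nonvanishing_lower_bound _ k g r) => //.
    - by move=> u ur; rewrite mulf_neq0 ?invr_eq0// fneq0//; exact: Ophi.
    - by move=> u ur; rewrite gE ler_pdivrMr// mul1r fB//; exact: Ophi.
    by rewrite (le_trans kP)// gE phi0 ler_pM2r ?invr_gt0.
  by rewrite gE ler_pdivlMr// mulrC.
have vi i : nrm (v 0 i) <= 4 * `|A| / r1.
  have d_phi : differentiable phi 0 by apply: hol; change (nrm (0 : R[i]) < r); rewrite Normc.normc0.
  have dcoord w : nrm w < r -> differentiable (fun w => phi w 0 i : R[i]) w.
    move=> wr; exact: (@differentiable_comp _ _ _ _ phi (fun M : 'rV[R[i]]_n => M 0 i) w
      (hol _ wr) (differentiable_coord _ _ _)).
  apply: (@cauchy_estimate _ (fun w => phi w 0 i : R[i]) 0 _ _ _ r10).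
  - by move=> w; rewrite subr0 => /r1r; exact: dcoord.
  - move=> w; rewrite subr0 => wr; rewrite (le_trans (nrm_le_enorm _ _))//.
    by rewrite (le_trans (phiA _ wr))// ler_norm.
  rewrite -dphi -(derive1_coord _ d_phi).
  by apply: differentiable_cderiv; apply: dcoord; rewrite Normc.normc0.
have vQ : enorm v <= Q / r.
  have K0 : 0 <= 4 * `|A| / r1 by rewrite divr_ge0 ?mulr_ge0// ltW.
  rewrite (le_trans (enorm_le K0 vi))//.
  have -> : n%:R * (4 * `|A| / r1) = (Q - 1) / r.
    by rewrite /Q /r1; field; rewrite !gt_eqF// exprn_gt0.
  by rewrite ler_pM2r ?invr_gt0//; lra.
by rewrite ler_pdivrMl.
Qed.
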